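(* Let $p\neq 2$ be a prime. (1) Let $F$ be a finite field extension of $\mathbb{Q}_p$, let $a\in F^{*}/(F^{*})^{2}$, let $A=\begin{pmatrix}0&1\\ a&0\end{pmatrix}$ and let $\theta_a:=\iota_A$ be the corresponding involution of $\mathrm{SL}(2,F)$. Then its fixed point group is $$H_{\theta_a}=\left\{\begin{pmatrix} x&y\\ ay&x\end{pmatrix}\in\mathrm{SL}(2,F)\ \middle|\ x^2-ay^2=1\right\}.$$ (2) Let $E=\mathbb{Q}_p(\alpha)$ be a quadratic extension of $\mathbb{Q}_p$, with $\alpha\in E\setminus \mathbb{Q}_p$, $\alpha^2\in\mathbb{Q}_p$, and let $\sigma(a+\alpha b)=a-\alpha b$ for $a,b\in\mathbb{Q}_p$. Let $\theta=\iota_A\circ\sigma$ be an abstract involution of $\mathrm{SL}(2,E)$, where $A\in\left\{\begin{pmatrix} z & y\\ 1 & -\sigma(z)\end{pmatrix},\ \begin{pmatrix} x & 0\\ 0 & 1\end{pmatrix}\right\}\subset \mathrm{GL}(2,E)$, with $y\in\mathbb{Q}_p$, $z,x\in E$, $z\sigma(z)+y\neq 0$ and $x\sigma(x)=1$. Then one of the following holds for $H_\theta:=\{g\in\mathrm{SL}(2,E)\mid\theta(g)=g\}$: (i) $H_\theta$ is $\mathrm{GL}(2,E)$-conjugate to $\mathrm{SL}(2,\mathbb{Q}_p)$; (ii) $H_\theta=B\,\mathrm{SL}(2,K^{\sigma})B^{-1}\cap\mathrm{SL}(2,E)$ for some matrix $B\in\mathrm{GL}(2,K)$, where $K\neq E$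 is some finite field extension of $E$ and $K^\sigma:=\{x\in K\mid\sigma(x)=x\}$ is the maximal subfield of $K$ fixed by $\sigma$. In particular, $H_\theta$ is compact or trivial.
   Context: An abstract involution of $\mathrm{SL}(2,k)$ ($k$ a local field) is a bi-continuous group automorphism of order two. For $A\in\mathrm{GL}(2,k)$, $\iota_A$ denotes $g\mapsto AgA^{-1}$ on $\mathrm{SL}(2,k)$. The fixed point group of an involution $\theta$ of a group $G$ is $H_\theta=\{g\in G\mid\theta(g)=g\}$. A field automorphism acts on matrices entrywise. Writing $a\in F^*/(F^* )^2$ for a matrix entry means that $a\in F^*$ is a representative of a class modulo squares. In (2)(ii), $\sigma$ is extended to a field automorphism of order two of $K$, still denoted $\sigma$ (so $\sigma(\alpha)=-\alpha$), in such a way that every element of $K$ can be written uniquely as $x_1+\alpha x_2$ with $x_1,x_2\in K^\sigma$; that is, $K=K^\sigma(\alpha)$ is quadratic over $K^\sigma$. *)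

(* Defs.v *)
From HB Require Import structures.
From mathcomp Require Import all_boot all_order all_algebra all_field.
From mathcomp Require Import boolp classical_sets functions topology.

Set Implicit Arguments.
Unset Strict Implicit.
Unset Printing Implicit Defensive.
Import GRing.Theory.
Local Open Scope classical_set_scope.
Local Open Scope ring_scope.

(* Inverse limit of the rings Z/p^(n+1). The primality proof is a parameter of
   the type so that the ring structures below can be inferred. *)
Record padic_int (p : nat) (p_pr : prime p) := PadicInt {
  residue : forall n, 'Z_(p ^ n.+1);
  residue_compat : forall n,
    (residue n.+1 : nat)%:R = residue n :> 'Z_(p ^ n.+1) }.

Section PadicInt.
Variables (p : nat) (p_pr : prime p).
Local Notation Zp := (padic_int p_pr).
Implicit Types x y z : Zp.

Let p_gt1 n : (1 < p ^ n.+1)%N.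
Proof. by rewrite -(exp1n n.+1) ltn_exp2r // prime_gt1. Qed.

Lemma padic_int_ext x y : (forall n, residue x n = residue y n) -> x = y.
Proof.
case: x y => [x xc] [y yc] /= xy.
have {}xy : x = y by apply: functional_extensionality_dep.
by subst y; congr PadicInt; apply: Prop_irrelevance.
Qed.

Let red n (u : 'Z_(p ^ n.+2)) : 'Z_(p ^ n.+1) := (u : nat)%:R.

Let red_nat n k : red (k%:R : 'Z_(p ^ n.+2)) = k%:R.
Proof.
apply: val_inj; rewrite /red /= !val_Zp_nat //= modn_dvdm //.
by rewrite dvdn_exp2l.
Qed.

Let redD n : {morph @red n : u v / u + v}.
Proof.
move=> u v; rewrite -[u]natr_Zp -[v]natr_Zp -natrD !red_nat.
by rewrite natrD.
Qed.

Let redM n : {morph @red n : u v / u * v}.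
Proof.
move=> u v; rewrite -[u]natr_Zp -[v]natr_Zp -natrM !red_nat.
by rewrite natrM.
Qed.

Let red0 n : @red n 0 = 0. Proof. by rewrite -[0]/(0%:R) red_nat. Qed.
Let red1 n : @red n 1 = 1. Proof. by rewrite -[1]/(1%:R) red_nat. Qed.

Let redN n : {morph @red n : u / - u}.
Proof.
by move=> u; apply/eqP; rewrite -subr_eq0 opprK -redD addNr red0.
Qed.

Definition padic_int_nat (k : nat) : Zp :=
  PadicInt p_pr (fun n => red_nat n k).

Definition padic_int_add x y : Zp :=
  @PadicInt p p_pr (fun n => residue x n + residue y n)
    (fun n => etrans (redD _ _)
       (congr2 +%R (residue_compat x n) (residue_compat y n))).

Definition padic_int_mul x y : Zp :=
  @PadicInt p p_pr (fun n => residue x n * residue y n)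
    (fun n => etrans (redM _ _)
       (congr2 *%R (residue_compat x n) (residue_compat y n))).

Definition padic_int_opp x : Zp :=
  @PadicInt p p_pr (fun n => - residue x n)
    (fun n => etrans (redN _) (congr1 -%R (residue_compat x n))).

HB.instance Definition _ := gen_eqMixin Zp.
HB.instance Definition _ := gen_choiceMixin Zp.

Let addA : associative padic_int_add.
Proof. by move=> x y z; apply: padic_int_ext => n /=; rewrite addrA. Qed.
Let addC : commutative padic_int_add.
Proof. by move=> x y; apply: padic_int_ext => n /=; rewrite addrC. Qed.
Let add0 : left_id (padic_int_nat 0) padic_int_add.
Proof. by move=> x; apply: padic_int_ext => n /=; rewrite add0r. Qed.
Let addN : left_inverse (padic_int_nat 0) padic_int_opp padic_int_add.
Proof. by move=> x; apply: padic_int_ext => n /=; rewrite addNr. Qed.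

HB.instance Definition _ := GRing.isZmodule.Build Zp addA addC add0 addN.

Let mulA : associative padic_int_mul.
Proof. by move=> x y z; apply: padic_int_ext => n /=; rewrite mulrA. Qed.
Let mulC : commutative padic_int_mul.
Proof. by move=> x y; apply: padic_int_ext => n /=; rewrite mulrC. Qed.
Let mul1 : left_id (padic_int_nat 1) padic_int_mul.
Proof. by move=> x; apply: padic_int_ext => n /=; rewrite mul1r. Qed.
Let mulD : left_distributive padic_int_mul padic_int_add.
Proof. by move=> x y z; apply: padic_int_ext => n /=; rewrite mulrDl. Qed.
Let one_neq0 : padic_int_nat 1 != 0.
Proof.
apply/eqP => /(congr1 (fun x => residue x 0)) /= /eqP.
by rewrite oner_eq0.
Qed.

HB.instance Definition _ :=
  GRing.Zmodule_isComNzRing.Build Zp mulA mulC mul1 mulD one_neq0.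

Definition padic_int_unit : pred Zp := fun x => `[< exists y, y * x = 1 >].

Definition padic_int_inv x : Zp :=
  if pselect (exists y, y * x = 1) is left e then projT1 (cid e) else x.

Let mulV : {in padic_int_unit, left_inverse 1 padic_int_inv *%R}.
Proof.
move=> x /asboolP xU; rewrite /padic_int_inv.
by case: pselect => // e; case: cid.
Qed.
Let unitP x y : y * x = 1 -> padic_int_unit x.
Proof. by move=> yx; apply/asboolP; exists y. Qed.
Let inv_out : {in [predC padic_int_unit], padic_int_inv =1 id}.
Proof.
move=> x /negP xU; rewrite /padic_int_inv; case: pselect => // e.
by case: xU; apply/asboolP.
Qed.

HB.instance Definition _ :=
  GRing.ComNzRing_hasMulInverse.Build Zp mulV unitP inv_out.

Lemma residue0 n : residue (0 : Zp) n = 0. Proof. by []. Qed.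
Lemma residue1 n : residue (1 : Zp) n = 1. Proof. by []. Qed.
Lemma residueD x y n : residue (x + y) n = residue x n + residue y n.
Proof. by []. Qed.
Lemma residueN x n : residue (- x) n = - residue x n.
Proof. by []. Qed.
Lemma residueM x y n : residue (x * y) n = residue x n * residue y n.
Proof. by []. Qed.

Lemma residue_leq x m n : (m <= n)%N ->
  (residue x n : nat)%:R = residue x m :> 'Z_(p ^ m.+1).
Proof.
move/subnKC <-; elim: (n - m)%N => [|k IH]; first by rewrite addn0 natr_Zp.
rewrite -IH -(residue_compat x (m + k)) addnS; apply: val_inj.
rewrite /= !val_Zp_nat // modn_dvdm //.
by rewrite dvdn_exp2l // ltnS leq_addr.
Qed.

Lemma residue_eq0 x m n : (m <= n)%N ->
  (residue x m == 0) = (p ^ m.+1 %| residue x n)%N.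
Proof.
move=> mn; rewrite -(residue_leq x mn) -val_eqE /= val_Zp_nat //.
Qed.

Let idomainP x y : x * y = 0 -> (x == 0) || (y == 0).
Proof.
move=> xy0; apply/norP => -[x0 y0].
have nz z : z != 0 -> exists n, residue z n != 0.
  move=> z0; apply/not_existsP => h; case/eqP: z0.
  by apply: padic_int_ext => n; apply/eqP/negPn/negP/h.
have [n xn] := nz _ x0; have [m ym] := nz _ y0.
pose k := (n + m).+1.
have nk : (n <= k)%N by rewrite /k -addnS leq_addr.
have mk : (m <= k)%N by rewrite /k -addSn leq_addl.
rewrite (residue_eq0 _ nk) in xn; rewrite (residue_eq0 _ mk) in ym.
have a0 : (0 < residue x k)%N.
  by rewrite lt0n; apply: contra xn => /eqP ->; rewrite dvdn0.
have b0 : (0 < residue y k)%N.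
  by rewrite lt0n; apply: contra ym => /eqP ->; rewrite dvdn0.
have : (p ^ k.+1 %| residue x k * residue y k)%N.
  have /(congr1 (fun z => residue z k)) := xy0.
  rewrite residueM residue0 -[residue x k in LHS]natr_Zp.
  rewrite -[residue y k in LHS]natr_Zp -natrM => /eqP.
  by rewrite -val_eqE /= val_Zp_nat.
rewrite pfactor_dvdn ?muln_gt0 ?a0 // lognM //.
rewrite !pfactor_dvdn // -!leqNgt in xn ym.
by apply/negP; rewrite -ltnNge ltnS (leq_trans (leq_add xn ym)).
Qed.

HB.instance Definition _ := GRing.ComUnitRing_isIntegral.Build Zp idomainP.

End PadicInt.

Definition padic (p : nat) (p_pr : prime p) : Type :=
  {fraction (padic_int p_pr)}.

Section Padic.
Variables (p : nat) (p_pr : prime p).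
Local Notation Zp := (padic_int p_pr).
Local Notation Qp := (padic p_pr).

HB.instance Definition _ := GRing.Field.on Qp.

Definition padic_of_int : Zp -> Qp := @FracField.tofrac Zp.

HB.instance Definition _ := GRing.RMorphism.on padic_of_int.

(* The sets x + p^n Z_p form a neighborhood basis at x. *)
Definition padic_ball (x : Qp) (n : nat) : set Qp :=
  [set x + p%:R ^+ n * padic_of_int z | z in [set: Zp]].

Definition padic_nbhs (x : Qp) : set_system Qp :=
  [set U | exists n, padic_ball x n `<=` U].

HB.instance Definition _ := hasNbhs.Build Qp padic_nbhs.

Let ball_center x n : padic_ball x n x.
Proof. by exists 0 => //; rewrite rmorph0 mulr0 addr0. Qed.

Let ball_le x m n : (m <= n)%N -> padic_ball x n `<=` padic_ball x m.
Proof.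
move=> mn _ [z _ <-]; exists (p%:R ^+ (n - m) * z) => //.
by rewrite rmorphM rmorphXn rmorph_nat mulrA -exprD subnKC.
Qed.

Let nbhs_filter (x : Qp) : ProperFilter (nbhs x).
Proof.
split; first by case=> n /(_ x (ball_center x n)).
split; first by exists 0%N.
- move=> U V [m mU] [n nV]; exists (maxn m n) => y xy; split.
    by apply: mU; apply: ball_le xy; apply: leq_maxl.
  by apply: nV; apply: ball_le xy; apply: leq_maxr.
- by move=> U V UV [n nU]; exists n; apply: subset_trans UV.
Qed.

Let nbhs_singleton (x : Qp) (U : set Qp) : nbhs x U -> U x.
Proof. by case=> n; apply; apply: ball_center. Qed.

Let nbhs_nbhs (x : Qp) (U : set Qp) : nbhs x U -> nbhs x (nbhs^~ U).
Proof.
case=> n nU; exists n => _ [z _ <-]; exists n => _ [z' _ <-].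
by apply: nU; exists (z + z') => //; rewrite rmorphD mulrDr addrA.
Qed.

HB.instance Definition _ :=
  Nbhs_isNbhsTopological.Build Qp nbhs_filter nbhs_singleton nbhs_nbhs.

(* A finite extension E of Q_p carries its topology of a finite-dimensional
    Q_p-vector space, i.e. the product topology of Q_p^n in a basis. *)
Definition padic_coord (E : fieldExtType Qp) (x : E) : 'rV[Qp]_(\dim {:E}) :=
  \row_i coord (vbasis {:E}) i x.

Definition ext_top (E : fieldExtType Qp) : topologicalType :=
  initial_topology (@padic_coord E).

(* As a type this is convertible to ['M[E]_2]. *)
Definition mx_top (E : fieldExtType Qp) : topologicalType := 'M[ext_top E]_2.

End Padic.

Definition mx2 (R : Type) (a b c d : R) : 'M[R]_2 :=
  \matrix_(i < 2, j < 2)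
    if i == ord0 then (if j == ord0 then a else b)
    else (if j == ord0 then c else d).

Definition SL2 (R : comPzRingType) : set 'M[R]_2 := [set g | \det g = 1].
Arguments SL2 : clear implicits.

(* SL(2, S) for a subring S of R, viewed inside SL(2, R). *)
Definition SL2_in (R : comPzRingType) (S : set R) : set 'M[R]_2 :=
  [set g | SL2 R g /\ forall i j, S (g i j)].

(* iota_A; only meaningful for invertible A, since [invmx] is the identity on
   noninvertible matrices. *)
Definition inner_aut (R : comUnitRingType) (A g : 'M[R]_2) : 'M[R]_2 :=
  A *m g *m invmx A.

Definition fixed_points (T : Type) (G : set T) (theta : T -> T) : set T :=
  [set g | G g /\ theta g = g].

Section Involution.
Variables (p : nat) (p_pr : prime p) (E : fieldExtType (padic p_pr)).
Implicit Type theta : 'M[E]_2 -> 'M[E]_2.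

(* An endomap of SL(2, E) is represented by a map on all matrices, whose values
   outside of SL(2, E) are irrelevant. *)
Definition SL2_continuous theta : Prop :=
  {within (SL2 E : set (mx_top E)),
     continuous (theta : mx_top E -> mx_top E)}.

Definition bicontinuous_automorphism theta : Prop :=
  {homo theta : g / SL2 E g} /\
  (forall g h, SL2 E g -> SL2 E h -> theta (g *m h) = theta g *m theta h) /\
  SL2_continuous theta /\
  exists theta' : 'M[E]_2 -> 'M[E]_2,
    [/\ {homo theta' : g / SL2 E g},
        forall g, SL2 E g -> theta' (theta g) = g,
        forall g, SL2 E g -> theta (theta' g) = g &
        SL2_continuous theta'].

Definition abstract_involution theta : Prop :=
  [/\ bicontinuous_automorphism theta,
      forall g, SL2 E g -> theta (theta g) = g &
      exists2 g, SL2 E g & theta g <> g].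

End Involution.

(* Main.v *)
From HB Require Import structures.
Require Import Defs.
From mathcomp Require Import all_boot all_order all_algebra all_field.
From mathcomp Require Import boolp classical_sets functions topology.
From mathcomp Require Import filter ring.
Set Implicit Arguments.
Unset Strict Implicit.
Unset Printing Implicit Defensive.
Import GRing.Theory.
Local Open Scope classical_set_scope.
Local Open Scope ring_scope.

(** Part (1) is the computation of the commutant of [A]. In part (2), the matrices
    [A] satisfy [A sigma(A) = c] for a scalar [c] of the base field, namely
    [c = z sigma(z) + y] for the first family and [c = 1] for the diagonal
    one, so the matrices [g] over [E] with [A sigma(g) = g A] form a
    quaternion algebra over the p-adic numbers, with class given by [c] and
    [d = alpha^2], and the fixed point group consists of its elements of reduced
    norm one.

    If [c] is a norm from [E], the algebra is split. Concretely, for [c = w sigma(w)]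
    and [lam = w^-1] the semilinear map [B |-> lam A sigma(B)] is an involution, so
    that averaging produces an invertible matrix [B] with [lam A sigma(B) = B]
    ([twisted_basisE]), and conjugation by [B] turns the twisted involution
    into entrywise conjugation ([fixed_points_descent]).

    If [c] is not a norm, the algebra is a division algebra. The same descent
    works over any quadratic extension [K = E(b)] whose conjugation fixes [b] and
    in which [c] becomes a norm. The choice [b^2 = c + d v^2] gives
    [c = (b + alpha v)(b - alpha v)], and it is a proper extension of [E] as soon
    as the radicand is neither a square nor [d] times a square; such a [v]
    exists because some natural number is a p-adic square while its successor
    is not ([splitting_radicand]). Compactness comes from the reduced norm,
    an anisotropic quadratic form in four variables: its level sets are bounded
    and closed. Both facts are obtained from ultralimits of p-adic integers
    ([anisotropic_level_bounded], [compact_anisotropic_level]). *)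

(** * The p-adic integers *)

Lemma free_ultrafilter_nat :
  exists U : set_system nat, UltraFilter U /\ forall n, U [set k | (n <= k)%N].
Proof.
have [U [UU Uoo]] := ultraFilterLemma (@eventually_filter).
by exists U; split => // n; apply: Uoo; exists n.
Qed.

Lemma ultra_fiber (T : Type) (U : set_system T) (UU : UltraFilter U)
  (V : finType) (f : T -> V) : exists v, U (f @^-1` [set v]).
Proof.
apply: contrapT => /forallNP nU.
have: \forall t \near U, forall v, f t <> v.
  apply: filter_forall => v.
  by have [/nU//|] := in_ultra_setVsetC (f @^-1` [set v]) UU.
by move=> /filter_ex[t] /(_ (f t)).
Qed.

Section PadicIntegers.
Variables (p : nat) (p_pr : prime p).
Local Notation Zp := (padic_int p_pr).

Lemma pexpS_gt1 n : (1 < p ^ n.+1)%N.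
Proof. by rewrite -(exp1n n.+1) ltn_exp2r // prime_gt1. Qed.

Lemma residue_natr k n : residue (k%:R : Zp) n = k%:R.
Proof. by elim: k => // k IH; rewrite !mulrSr residueD IH residue1. Qed.

Lemma Zp_natr_eq n k m : (k%:R == m%:R :> 'Z_(p ^ n.+1)) = (k == m %[mod p ^ n.+1])%N.
Proof. by rewrite -val_eqE /= !val_Zp_nat ?pexpS_gt1. Qed.

Lemma Zp_natr_eq0 n k : (k%:R == 0 :> 'Z_(p ^ n.+1)) = (p ^ n.+1 %| k)%N.
Proof. by rewrite -(mulr0n 1) Zp_natr_eq mod0n. Qed.

Lemma residue_nat (x : Zp) n : residue x n = (residue x n : nat)%:R.
Proof. by rewrite natr_Zp. Qed.

(** This is sequential compactness of the p-adic integers in the form used below: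
    each residue takes finitely many values, so the ultrafilter selects one of
    them, and the selected residues are compatible because two sets of an
    ultrafilter always meet. *)
Lemma padic_int_ultralimit (T : Type) (U : set_system T) (UU : UltraFilter U)
  (f : T -> Zp) : exists l : Zp, forall n, U [set t | residue (f t) n = residue l n].
Proof.
pose r n := projT1 (cid (ultra_fiber UU (fun t => residue (f t) n))).
have rP n : U [set t | residue (f t) n = r n] by rewrite /r; case: cid.
suff rc n : (r n.+1 : nat)%:R = r n :> 'Z_(p ^ n.+1) by exists (PadicInt p_pr rc).
have [t [<- <-]] := filter_ex (filterI (rP n.+1) (rP n)).
exact: residue_compat.
Qed.

Lemma residue_dvd (x : Zp) n :
  residue x n = 0 -> exists y, x = p%:R ^+ n.+1 * y.
Proof.
move=> x0.
have dv k : (n <= k)%N -> (p ^ n.+1 %| residue x k)%N.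
  by move=> nk; rewrite -residue_eq0 //; apply/eqP.
(* The residue of the quotient at level [k] needs [n.+1] more digits of [x]. *)
pose y k : 'Z_(p ^ k.+1) := (residue x (k + n.+1) %/ p ^ n.+1)%N%:R.
have pn0 : (0 < p ^ n.+1)%N by rewrite ltnW ?pexpS_gt1.
have yc k : (y k.+1 : nat)%:R = y k :> 'Z_(p ^ k.+1).
  apply/eqP; rewrite Zp_natr_eq [y _]/y val_Zp_nat ?pexpS_gt1 //.
  rewrite modn_dvdm ?dvdn_exp2l //.
  have := residue_compat x (k + n.+1).
  move/eqP; rewrite -[X in _ == X]natr_Zp Zp_natr_eq => /eqP E.
  have d1 := dv (k.+1 + n.+1)%N (leq_trans (leqnSn n) (leq_addl _ _)).
  have d2 := dv (k + n.+1)%N (leq_trans (leqnSn n) (leq_addl _ _)).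
  rewrite -(eqn_pmul2r pn0) !muln_modl -expnD addSn (divnK d1) (divnK d2).
  by apply/eqP.
exists (PadicInt p_pr yc); apply: padic_int_ext => k.
rewrite residueM -natrX residue_natr /= /y -natrM.
rewrite mulnC divnK; last by apply/dv/(leq_trans (leqnSn n))/leq_addl.
by rewrite (residue_leq x (leq_addr n.+1 k)).
Qed.

Lemma residue_pexp (y : Zp) n k : (k <= n)%N -> residue (p%:R ^+ n.+1 * y) k = 0.
Proof.
move=> kn; rewrite residueM -natrX residue_natr.
suff -> : (p ^ n.+1)%:R = 0 :> 'Z_(p ^ k.+1) by rewrite mul0r.
by apply/eqP; rewrite Zp_natr_eq0 dvdn_exp2l.
Qed.

Lemma padic_int_natr_neq0 k : (0 < k)%N -> (k%:R : Zp) != 0.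
Proof.
move=> k0; apply/eqP => /(congr1 (fun x => residue x k)).
rewrite residue_natr residue0 => /eqP; rewrite Zp_natr_eq0 => /(dvdn_leq k0).
by rewrite leqNgt (leq_trans (ltn_expl k (prime_gt1 p_pr))) ?leq_exp2l ?prime_gt1.
Qed.

(** If the residue of [b] modulo [p ^ m.+1] is nonzero, then the gcd of [b] with
    every power of [p] divides [p ^ m], so Bezout solves [b * w = p ^ m] modulo
    each power of [p]; an ultralimit of these solutions is an exact one. *)
Lemma padic_int_dvd_pexp (b : Zp) : b != 0 -> exists m (w : Zp), b * w = p%:R ^+ m.
Proof.
move=> b0; have [m bm] : exists m, residue b m != 0.
  apply/not_existsP => h; case/eqP: b0.
  by apply: padic_int_ext => n; apply/eqP/negPn/negP/h.
exists m.
have sol n : exists w : Zp, residue (b * w) n = residue (p%:R ^+ m : Zp) n.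
  have /(dvdn_pfactor _ _ p_pr)[g gn gE] := dvdn_gcdl (p ^ n.+1) (residue b n).
  have gm : (g <= m)%N.
    have [nm|mn] := ltnP n m; first exact: leq_trans gn nm.
    rewrite leqNgt; apply: contra bm => mg; rewrite (residue_eq0 _ mn).
    by rewrite (dvdn_trans _ (dvdn_gcdr (p ^ n.+1) _)) // gE dvdn_exp2l.
  have [|a _] := Bezoutl (residue b n) (m := p ^ n.+1); first by rewrite ltnW ?pexpS_gt1.
  rewrite gE => /dvdnP[q qE]; exists (- (a%:R * p%:R ^+ (m - g))).
  have : residue (p%:R ^+ g + a%:R * b) n = 0.
    rewrite residueD residueM -natrX !residue_natr [residue b n]residue_nat.
    by apply/eqP; rewrite -natrM -natrD qE Zp_natr_eq0 dvdn_mull.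
  move=> E; rewrite -[in RHS](subnKC gm) exprD.
  have -> : b * - (a%:R * p%:R ^+ (m - g)) =
    p%:R ^+ g * p%:R ^+ (m - g) - (p%:R ^+ g + a%:R * b) * p%:R ^+ (m - g) by ring.
  by rewrite residueD residueN [in X in _ - X]residueM E mul0r subr0.
have [U [UU Uoo]] := free_ultrafilter_nat.
have [w wP] := boolp.choice sol; have [l lP] := padic_int_ultralimit UU w.
exists l; apply: padic_int_ext => n.
have [k [lk nk]] := filter_ex (filterI (lP n) (Uoo n)).
rewrite residueM -lk -residueM.
by rewrite -(residue_leq (b * _) nk) wP residue_leq.
Qed.
End PadicIntegers.

(** * The p-adic numbers *)

Lemma fraction_numden (R : idomainType) (x : {fraction R}) :
  exists a b, b != 0 /\ x * FracField.tofrac b = FracField.tofrac a.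
Proof.
elim/quotW: x => r; exists (frac r).1, (frac r).2; split; first exact: denom_ratioP.
unlock FracField.tofrac; rewrite -[LHS]FracField.pi_mul.
apply/eqP; rewrite piE FracField.equivfE /FracField.mulf /=.
rewrite !numden_Ratio ?oner_eq0 ?mulr1 ?denom_ratioP //.
by rewrite mulrC.
Qed.

Section PadicNumbers.
Variables (p : nat) (p_pr : prime p).
Local Notation Zp := (padic_int p_pr).
Local Notation Qp := (padic p_pr).
Local Notation iota := (@padic_of_int p p_pr).

Lemma padic_of_int_eq0 z : (iota z == 0) = (z == 0).
Proof. exact: tofrac_eq0. Qed.

Lemma padic_of_int_inj : injective iota.
Proof. by move=> x y /eqP; rewrite [_ == _]tofrac_eq => /eqP. Qed.

Lemma padic_natr_neq0 k : (0 < k)%N -> (k%:R : Qp) != 0.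
Proof.
by move=> k0; rewrite -(rmorph_nat iota) padic_of_int_eq0 padic_int_natr_neq0.
Qed.

Lemma padic_pexp_neq0 k : (p%:R ^+ k : Qp) != 0.
Proof. by rewrite expf_neq0 // padic_natr_neq0 // prime_gt0. Qed.

Lemma padic_denominator (x : Qp) : exists k z, p%:R ^+ k * x = iota z.
Proof.
have [a [b [b0 xb]]] : exists a b, b != 0 /\ x * iota b = iota a := fraction_numden x.
have [m [w bw]] := padic_int_dvd_pexp b0; exists m, (a * w).
by rewrite rmorphM /= -xb -mulrA -rmorphM /= bw rmorphXn rmorph_nat mulrC.
Qed.

Lemma padic_common_denominator (I : finType) (x : I -> Qp) :
  exists k, forall i, exists z, p%:R ^+ k * x i = iota z.
Proof.
have [k kP] := boolp.choice (fun i => padic_denominator (x i)).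
exists (\sum_i k i)%N => i; have [z zE] := kP i.
exists (p%:R ^+ (\sum_(j | j != i) k j) * z).
by rewrite (bigD1 i) //= addnC exprD -mulrA zE rmorphM rmorphXn rmorph_nat.
Qed.

Lemma residue_sqr_eq0 (z : Zp) : residue (z ^+ 2) 0 = 0 -> residue z 0 = 0.
Proof.
rewrite expr2 residueM [residue z 0]residue_nat -natrM.
move: (nat_of_ord _) => k /eqP pkk; apply/eqP; move: pkk.
by rewrite !(Zp_natr_eq0 p_pr) expn1 Euclid_dvdM // orbb.
Qed.

(** Divide by [p ^ 2] until the right-hand side is [p] itself; one more division
    would make [p] a unit. *)
Lemma padic_int_sqr_odd_pexp k (z : Zp) : z ^+ 2 <> p%:R ^+ k.*2.+1.
Proof.
elim: k z => [|k IH] z zE.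
  have [y yE] : exists y, z = p%:R ^+ 1 * y.
    by apply/residue_dvd/residue_sqr_eq0; rewrite zE -[_ ^+ _]mulr1 residue_pexp.
  move: zE; rewrite yE exprMn expr1 expr2 -mulrA -[RHS]mulr1.
  move=> /(mulfI (padic_int_natr_neq0 _ (prime_gt0 p_pr))) /(congr1 (fun x => residue x 0)).
  by rewrite -[p%:R]expr1 residue_pexp.
have [y yE] : exists y, z = p%:R ^+ 1 * y.
  apply/residue_dvd/residue_sqr_eq0.
  by rewrite zE -[_ ^+ _]mulr1 exprS -mulrA -[p%:R]expr1 residue_pexp.
apply: (IH y); move: zE; rewrite yE exprMn expr1 (exprD p%:R 2 k.*2.+1).
by apply/mulfI/expf_neq0/padic_int_natr_neq0/prime_gt0.
Qed.

Lemma padic_natp_not_sqr (x : Qp) : x ^+ 2 <> p%:R.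
Proof.
move=> xE; have [k [z zE]] := padic_denominator x.
apply: (@padic_int_sqr_odd_pexp k z); apply: padic_of_int_inj.
rewrite !rmorphXn rmorph_nat /= -zE exprMn xE -exprM muln2.
by rewrite exprSr.
Qed.

(** Otherwise an induction starting from [0] would make every natural number a
    square, among them [p]. *)
Lemma padic_sqr_succ_not_sqr :
  exists (n : nat) (t : Qp), t ^+ 2 = n%:R /\ forall s : Qp, s ^+ 2 <> n.+1%:R.
Proof.
apply: contrapT => H; suff: forall n, exists t : Qp, t ^+ 2 = n%:R.
  by move=> /(_ p)[t /padic_natp_not_sqr].
elim=> [|n [t tn]]; first by exists 0; rewrite expr0n.
by apply: contrapT => /forallNP h; apply: H; exists n, t; split.
Qed.

End PadicNumbers.

(** * Level sets of anisotropic forms *)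

Section AnisotropicForms.
Variables (p : nat) (p_pr : prime p).
Local Notation Zp := (padic_int p_pr).
Local Notation Qp := (padic p_pr).
Local Notation iota := (@padic_of_int p p_pr).

Lemma residue_sum (I : Type) (r : seq I) (P : pred I) (f : I -> Zp) n :
  residue (\sum_(i <- r | P i) f i) n = \sum_(i <- r | P i) residue (f i) n.
Proof. exact: (big_morph (fun x : Zp => residue x n)). Qed.

Lemma residue_eq_sub (x y : Zp) n :
  residue x n = residue y n -> exists z, x - y = p%:R ^+ n.+1 * z.
Proof.
by move=> xy; apply: residue_dvd; rewrite residueD residueN xy subrr.
Qed.

(** Residues of polynomial expressions only depend on residues, so an equation
    that holds in the limit modulo every power of [p] holds for the
    ultralimits. *)
Lemma ultralimit_form (T : Type) (U : set_system T) (UU : UltraFilter U)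
  (I : finType) (c : I -> Zp) (z : T -> I -> Zp) (l : I -> Zp) (r : Zp) :
  (forall i n, U [set t | residue (z t i) n = residue (l i) n]) ->
  (forall n, U [set t | residue (\sum_i c i * z t i ^+ 2) n = residue r n]) ->
  \sum_i c i * l i ^+ 2 = r.
Proof.
move=> zl zr; apply: padic_int_ext => n.
have zln : U [set t | forall i, residue (z t i) n = residue (l i) n].
  by apply: filter_forall => i; apply: zl.
have [t [/= tl <-]] := filter_ex (filterI zln (zr n)).
rewrite !residue_sum; apply: eq_bigr => i _.
by rewrite !expr2 !residueM tl.
Qed.

(** The least exponent that clears the denominators works: if all residues
    vanished, dividing by [p] would lower it. *)
Lemma primitive_scaling (I : finType) (x : I -> Qp) M :
  ~ (forall i, exists z, p%:R ^+ M * x i = iota z) ->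
  exists k (z : I -> Zp), [/\ (M < k)%N, forall i, p%:R ^+ k * x i = iota (z i) &
    exists i, residue (z i) 0 != 0].
Proof.
move=> xM; pose Q k := `[< forall i, exists z, p%:R ^+ k * x i = iota z >].
have exQ : exists k, Q k.
  by have [k kP] := padic_common_denominator x; exists k; apply/asboolP.
case: (ex_minnP exQ) => k /asboolP kP kmin.
have [z zP] := boolp.choice kP.
have Mk : (M < k)%N.
  rewrite ltnNge; apply/negP => kM; apply: xM => i.
  exists (p%:R ^+ (M - k) * z i).
  by rewrite rmorphM rmorphXn rmorph_nat /= -zP mulrA -exprD subnK.
exists k, z; split=> //; apply: contrapT => /forallNP z0.
have {Mk}[k' kE] : exists k', k = k'.+1 by exists k.-1; rewrite (ltn_predK Mk).
subst k; rename k' into k.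
have: Q k; last by move=> /kmin; rewrite ltnn.
apply/asboolP => i; have /negP/negPn/eqP/residue_dvd[y yE] := z0 i.
exists y; apply: (mulfI (padic_pexp_neq0 p_pr 1)).
by rewrite mulrA -exprD add1n zP yE rmorphM rmorphXn rmorph_nat.
Qed.

(** Solutions with unbounded denominators, rescaled to primitive vectors, give
    primitive vectors on which the form is divisible by arbitrarily large powers
    of [p]; their ultralimit is a primitive, hence nonzero, zero of the form. *)
Lemma anisotropic_level_bounded (I : finType) (c : I -> Qp) (r : Qp) :
  (forall x : I -> Qp, \sum_i c i * x i ^+ 2 = 0 -> forall i, x i = 0) ->
  exists M, forall x : I -> Qp, \sum_i c i * x i ^+ 2 = r ->
    forall i, exists z, p%:R ^+ M * x i = iota z.
Proof.
move=> aniso; apply: contrapT => /forallNP unbounded.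
have sol M : exists kz : nat * (I -> Zp), [/\ (M < kz.1)%N,
    \sum_i c i * iota (kz.2 i) ^+ 2 = (p%:R ^+ kz.1) ^+ 2 * r &
    exists i, residue (kz.2 i) 0 != 0].
  have /existsNP[x /not_implyP[xr /primitive_scaling[k [z [Mk zE zprim]]]]] := unbounded M.
  exists (k, z); split=> //=; rewrite -xr mulr_sumr; apply: eq_bigr => i _.
  by rewrite -zE; ring.
have [kz kzP] := boolp.choice sol.
(* Index [None] stands for [r]: one power of [p] clears all denominators. *)
have [j /boolp.choice[cr crE]] := padic_common_denominator
    (fun i : option I => if i is Some i then c i else r).
have [U [UU Uoo]] := free_ultrafilter_nat.
have [l lP] := boolp.choice (fun i => padic_int_ultralimit UU (fun M => (kz M).2 i)).
have l0 : \sum_i cr (Some i) * l i ^+ 2 = 0.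
  apply: (ultralimit_form UU lP) => n.
  apply: filterS (Uoo n) => M /= nM; have [Mk kzr _] := kzP M.
  suff -> : \sum_i cr (Some i) * (kz M).2 i ^+ 2 =
      p%:R ^+ (kz M).1.-1.+1 * (p%:R ^+ (kz M).1 * cr None).
    by rewrite residue_pexp // -ltnS (ltn_predK Mk) (leq_ltn_trans nM).
  rewrite (ltn_predK Mk); apply: padic_of_int_inj.
  rewrite rmorph_sum !rmorphM !rmorphXn !rmorph_nat /= -crE.
  under eq_bigr do rewrite rmorphM rmorphXn /= -crE -mulrA.
  by rewrite -mulr_sumr kzr; ring.
have lz i : l i = 0.
  apply/eqP; rewrite -padic_of_int_eq0; apply/eqP.
  apply: (aniso (fun i => iota (l i))); apply: (mulfI (padic_pexp_neq0 p_pr j)).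
  rewrite mulr0; transitivity (iota (\sum_i cr (Some i) * l i ^+ 2)).
    2: by rewrite l0 rmorph0.
  rewrite mulr_sumr rmorph_sum; apply: eq_bigr => k _.
  by rewrite rmorphM rmorphXn /= -crE mulrA.
have [M Ml] : exists M, forall i, residue ((kz M).2 i) 0 = residue (l i) 0.
  by apply: (filter_ex (F := U)); apply: filter_forall => i; apply: lP.
by have [_ _ [i]] := kzP M; rewrite Ml lz residue0 eqxx.
Qed.

(** Entrywise and in coordinates over the p-adic numbers, [G] is linear with
    bounded denominators, so agreement of high residues of the parameters puts
    the matrices in a prescribed ball. *)
Lemma mx_top_cvg (E : fieldExtType Qp) (F : set_system (mx_top E)) (FF : Filter F)
  (I : finType) (P : I -> 'M[E]_2) (M : nat) (z : 'M[E]_2 -> I -> Zp) (l : I -> Zp) :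
  let G x : 'M[E]_2 := \sum_i (p%:R ^- M * iota (x i))%:A *: P i in
  (forall i n, F [set g | residue (z g i) n = residue (l i) n]) ->
  F [set g | g = G (z g)] -> F --> (G l : mx_top E).
Proof.
move=> G zl FG A [Q /= GQ QA].
apply: filterS QA _.
apply: filter_forall => i; apply: filter_forall => j.
have [_ [[B Bop <-] /= BG BQ]] := GQ i j.
have : nbhs (padic_coord (G l i j)) B by rewrite nbhsE; exists B.
case=> V /= GV VB.
suff: F [set g | forall a b, V a b (padic_coord (g i j) a b)].
  by apply: filterS => g gV; apply/BQ/VB.
apply: filter_forall => a; apply: filter_forall => b.
have [n nV] := GV a b.
pose kappa m := coord (vbasis {:E}) b (P m i j).
have coordG x : padic_coord (G x i j) a b = \sum_m (p%:R ^- M * iota (x m)) * kappa m.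
  rewrite mxE summxE linear_sum; apply: eq_bigr => m _.
  by rewrite mxE mulr_algl linearZ.
have [s sP] := padic_common_denominator (fun m => p%:R ^- M * kappa m).
have [w wE] := boolp.choice sP.
have zls : F [set g | forall i, residue (z g i) (n + s) = residue (l i) (n + s)].
  by apply: filter_forall => m; apply: zl.
apply: filterS (filterI zls FG) => g [/= gl gG]; apply: nV.
have [y yE] := boolp.choice (fun m => residue_eq_sub (gl m)).
exists (\sum_m p%:R * y m * w m) => //.
rewrite gG !coordG rmorph_sum mulr_sumr -big_split /=; apply: eq_bigr => m _.
rewrite -[z g m](subrK (l m)) yE rmorphD !rmorphM rmorphXn !rmorph_nat /= -wE.
rewrite exprSr exprD; ring.
Qed.

(** By the bound on denominators the level set is parametrized by integral
    vectors, and an ultrafilter on it converges to the matrix of the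
    ultralimits of these vectors. *)
Lemma compact_anisotropic_level (E : fieldExtType Qp) (I : finType)
    (c : I -> Qp) (r : Qp) (P : I -> 'M[E]_2) :
  (forall x : I -> Qp, \sum_i c i * x i ^+ 2 = 0 -> forall i, x i = 0) ->
  compact ([set \sum_i (x i)%:A *: P i | x in
    [set x : I -> Qp | \sum_i c i * x i ^+ 2 = r]] : set (mx_top E)).
Proof.
move=> aniso; set H := (X in compact X).
have [M Mbd] := anisotropic_level_bounded r aniso.
have [j /boolp.choice[cr crE]] := padic_common_denominator
    (fun i : option I => if i is Some i then c i else (p%:R ^+ M) ^+ 2 * r).
pose G x : 'M[E]_2 := \sum_i (p%:R ^- M * iota (x i))%:A *: P i.
have pM0 : p%:R ^+ M != 0 :> Qp := padic_pexp_neq0 p_pr M.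
have levelE (x : I -> Qp) (z : I -> Zp) :
    (forall i, p%:R ^+ M * x i = iota (z i)) ->
    \sum_i c i * x i ^+ 2 = r <-> \sum_i cr (Some i) * z i ^+ 2 = cr None.
  move=> xz; have pp0 : p%:R ^+ j * (p%:R ^+ M) ^+ 2 != 0 :> Qp.
    by rewrite mulf_neq0 ?expf_neq0 ?padic_natr_neq0 ?prime_gt0.
  have E1 : iota (\sum_i cr (Some i) * z i ^+ 2) =
      p%:R ^+ j * (p%:R ^+ M) ^+ 2 * \sum_i c i * x i ^+ 2.
    rewrite rmorph_sum mulr_sumr; apply: eq_bigr => i _.
    by rewrite rmorphM rmorphXn /= -crE -xz; ring.
  split=> [xr|zr].
    by apply: padic_of_int_inj; rewrite E1 xr -crE mulrA.
  by apply: (mulfI pp0); rewrite -E1 zr -crE mulrA.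
have sol g : exists z : I -> Zp,
    H g -> g = G z /\ \sum_i cr (Some i) * z i ^+ 2 = cr None.
  have [[x xr <-]|nHg] := pselect (H g); last by exists (fun=> 0).
  have [z zE] := boolp.choice (Mbd _ xr); exists z => _; split.
    by apply: eq_bigr => i _; rewrite -zE mulKf.
  by apply/(levelE x).
have [z zP] := boolp.choice sol.
rewrite compact_ultra => F UF FH.
have [l lP] := boolp.choice (fun i => padic_int_ultralimit UF (fun g => z g i)).
exists (G l); split.
  exists (fun i => p%:R ^- M * iota (l i)) => //.
  apply/(levelE _ l); first by move=> i; rewrite mulVKf.
  by apply: (ultralimit_form UF lP) => n; apply: filterS FH => g /zP[_ zr] /=; rewrite zr.
by apply: (@mx_top_cvg E F _ I P M z l) => //; apply: filterS FH => g /zP[].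
Qed.
End AnisotropicForms.

(** * Quadratic extensions *)

Section QuadraticExtensions.
Variables (F : fieldType) (L : fieldExtType F) (b : L).
Hypotheses (dimL : \dim {:L} = 2%N) (bN1 : b \notin 1%VS).

Lemma quadratic_span (x : L) : exists u v : F, x = u%:A + b * v%:A.
Proof.
have b_free : free [:: b; 1].
  by rewrite free_cons span_seq1 bN1 seq1_free oner_neq0.
have: x \in <<[:: b; 1%R]>>%VS.
  suff -> : <<[:: b; 1%R]>>%VS = fullv by rewrite memvf.
  apply/eqP; rewrite eqEdim subvf dimL /=.
  by move: b_free; rewrite /free => /eqP ->.
rewrite span_cons span_seq1 => /memv_addP[_ /vlineP[v ->]] [_ /vlineP[u ->]] ->.
by exists u, v; rewrite addrC mulr_algr.
Qed.

Lemma quadratic_coord_uniq (u v u' v' : F) :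
  u%:A + b * v%:A = u'%:A + b * v'%:A -> u = u' /\ v = v'.
Proof.
move=> E; have vE : v = v'.
  apply: contraNeq bN1 => vv'.
  have {}E : b * (v - v')%:A = (u' - u)%:A.
    rewrite !scalerBl; transitivity (u%:A + b * v%:A - u%:A - b * v'%:A); first by ring.
    by rewrite E; ring.
  apply/vlineP; exists ((u' - u) / (v - v')).
  rewrite mulrC -scalerA -E mulr_algr scalerA mulVf ?subr_eq0 // scale1r //.
by split=> //; move: E; rewrite vE => /addIr /(fmorph_inj (in_alg L)).
Qed.

(** Both conjugations of the theorem are instances: that of [E], with [s] the
    identity and [b' = - b], and its extension to [K = E(b)], with [s] the
    conjugation of [E] and [b' = b]. *)
Lemma quadratic_morphism (s : {rmorphism F -> F}) (m : F) (b' : L) :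
  b ^+ 2 = m%:A -> b' ^+ 2 = (s m)%:A ->
  exists tau : {rmorphism L -> L},
    forall u v : F, tau (u%:A + b * v%:A) = (s u)%:A + b' * (s v)%:A.
Proof.
move=> b2 b'2.
have [u uP] := boolp.choice quadratic_span.
have [v vP] := boolp.choice uP.
pose tau x := (s (u x))%:A + b' * (s (v x))%:A.
have tauE u' v' : tau (u'%:A + b * v'%:A) = (s u')%:A + b' * (s v')%:A.
  by rewrite /tau; have [<- <-] := quadratic_coord_uniq (vP (u'%:A + b * v'%:A)).
have tauB : zmod_morphism tau.
  move=> x y; rewrite [in LHS](vP x) [in LHS](vP y).
  rewrite (_ : _ - _ = (u x - u y)%:A + b * (v x - v y)%:A).
    by rewrite tauE /tau !rmorphB !scalerBl; ring.
  by rewrite !scalerBl; ring.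
have algM (x y : F) : (x * y)%:A = x%:A * y%:A :> L := rmorphM (in_alg L) x y.
have tauM : monoid_morphism tau.
  split=> [|x y].
    rewrite -[1 in LHS](scale1r 1) -[_%:A in LHS]addr0 -(mulr0 b) -(scale0r 1).
    by rewrite tauE rmorph1 rmorph0 scale0r mulr0 addr0 scale1r.
  rewrite (_ : x * y = (u x * u y + m * (v x * v y))%:A + b * (u x * v y + v x * u y)%:A).
    rewrite tauE /tau !rmorphD !rmorphM /=.
    rewrite !scalerDl !algM -b'2; ring.
  rewrite [in LHS](vP x) [in LHS](vP y).
  rewrite !scalerDl !algM -b2; ring.
pose T : {rmorphism L -> L} := HB.pack tau
  (GRing.isZmodMorphism.Build L L tau tauB) (GRing.isMonoidMorphism.Build L L tau tauM).
by exists T.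
Qed.
End QuadraticExtensions.

Lemma quadratic_extension (F : fieldType) (m : F) : (forall r : F, r ^+ 2 <> m) ->
  exists (L : fieldExtType F) (b : L),
    [/\ \dim {:L} = 2%N, b \notin 1%VS & b ^+ 2 = m%:A].
Proof.
move=> mN; have sz : size ('X^2 - m%:P : {poly F}) = 3 by rewrite size_XnsubC.
have : irreducible_poly ('X^2 - m%:P).
  apply: cubic_irreducible; rewrite ?sz // => r.
  by apply/negP; rewrite /root !hornerE subr_eq0 => /eqP/mN.
move=> /irredp_FAdjoin[L dimL [b]].
rewrite rmorphB /= map_polyXn map_polyC /root !hornerE subr_eq0 => /eqP b2 _.
exists L, b; split=> //; first by rewrite dimL sz.
apply/negP => /vlineP[r bE]; apply: (mN r).
by apply: (fmorph_inj (in_alg L)); rewrite rmorphXn /= -bE b2.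
Qed.

(** * Two by two matrices and descent *)

Section Matrices2.
Variable R : comPzRingType.
Implicit Types a b c d : R.

Lemma mx2_eta (M : 'M[R]_2) : M = mx2 (M 0 0) (M 0 1) (M 1 0) (M 1 1).
Proof.
apply/matrixP => i j; rewrite mxE.
by case: i => [[|[|i]] Hi] //; case: j => [[|[|j]] Hj] //=; congr (M _ _); apply: val_inj.
Qed.

Lemma mx2_inj a b c d a' b' c' d' :
  mx2 a b c d = mx2 a' b' c' d' -> [/\ a = a', b = b', c = c' & d = d'].
Proof.
move=> E; have e i j := congr1 (fun M : 'M[R]_2 => M i j) E.
by split; [have := e 0 0 | have := e 0 1 | have := e 1 0 | have := e 1 1]; rewrite !mxE.
Qed.

Lemma mulmx2 a b c d a' b' c' d' :
  mx2 a b c d *m mx2 a' b' c' d' =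
  mx2 (a * a' + b * c') (a * b' + b * d') (c * a' + d * c') (c * b' + d * d').
Proof.
apply/matrixP => i j; rewrite !mxE !big_ord_recl big_ord0 !mxE /= addr0.
by case: i => [[|[|i]] Hi] //; case: j => [[|[|j]] Hj].
Qed.

Lemma det_mx2 a b c d : \det (mx2 a b c d) = a * d - b * c.
Proof.
rewrite (expand_det_row _ 0) !big_ord_recl big_ord0 /cofactor !det_mx11 !mxE /=.
by rewrite addr0 expr0 mul1r expr1 mulN1r mulrN.
Qed.

Lemma scale_mx2 e a b c d : e *: mx2 a b c d = mx2 (e * a) (e * b) (e * c) (e * d).
Proof.
by apply/matrixP => i j; rewrite !mxE; do 2 case: ifP.
Qed.

Lemma add_mx2 a b c d a' b' c' d' :
  mx2 a b c d + mx2 a' b' c' d' = mx2 (a + a') (b + b') (c + c') (d + d').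
Proof.
by apply/matrixP => i j; rewrite !mxE; do 2 case: ifP.
Qed.

Lemma map_mx2 (S : Type) (f : R -> S) a b c d :
  map_mx f (mx2 a b c d) = mx2 (f a) (f b) (f c) (f d).
Proof.
by apply/matrixP => i j; rewrite !mxE; do 2 case: ifP.
Qed.
End Matrices2.

Section TwistedFixedPoints.
Variables (K : fieldType).
Implicit Types (A B g h : 'M[K]_2).

Lemma inner_aut_eq A g h : A \in unitmx -> inner_aut A g = h <-> A *m g = h *m A.
Proof.
move=> Au; rewrite /inner_aut; split=> [<-|->]; first by rewrite mulmxKV.
by rewrite mulmxK.
Qed.

Lemma inner_autK A g : A \in unitmx -> inner_aut (invmx A) (inner_aut A g) = g.
Proof.
by move=> Au; rewrite /inner_aut invmxK !mulmxA mulVmx // mul1mx mulmxKV.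
Qed.

Lemma inner_autVK A g : A \in unitmx -> inner_aut A (inner_aut (invmx A) g) = g.
Proof. by move=> Au; rewrite -{1}(invmxK A) inner_autK ?unitmx_inv. Qed.

Lemma det_inner_aut A g : A \in unitmx -> \det (inner_aut A g) = \det g.
Proof.
rewrite unitmxE unitfE => dA.
by rewrite /inner_aut !det_mulmx det_inv mulrAC mulfV // mul1r.
Qed.

Lemma inner_aut_map (L : fieldType) (f : {rmorphism K -> L}) A g :
  map_mx f (inner_aut A g) = inner_aut (map_mx f A) (map_mx f g).
Proof. by rewrite /inner_aut !map_mxM map_invmx. Qed.

(** Galois descent: when [B] is a fixed vector, up to the scalar [lam], of the
    semilinear map [B |-> A tau(B)], conjugation by [B] carries the entrywise
    action of [tau] to the twisted involution, so the fixed points of the two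
    correspond. *)
Lemma fixed_points_descent (tau : {rmorphism K -> K}) A B (lam : K) :
  A \in unitmx -> B \in unitmx -> lam *: (A *m map_mx tau B) = B ->
  fixed_points (SL2 K) (inner_aut A \o map_mx tau) =
  [set inner_aut B h | h in SL2_in [set x | tau x = x]].
Proof.
move=> Au Bu BE.
have thetaE h : inner_aut A (map_mx tau (inner_aut B h)) = inner_aut B (map_mx tau h).
  rewrite inner_aut_map; apply/inner_aut_eq => //; apply/esym.
  have tBu : map_mx tau B \in unitmx by rewrite map_unitmx.
  have lam0 : lam != 0.
    by apply: contraTneq Bu => l0; rewrite -BE l0 scale0r unitmxE det0 unitr0.
  have AE : A = lam^-1 *: (B *m invmx (map_mx tau B)).
    rewrite -[X in X *m _]BE -scalemxAl scalerA mulVf // scale1r mulmxK //.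
  rewrite {}AE /inner_aut -scalemxAl -scalemxAr.
  by rewrite !mulmxA !mulmxKV.
apply/seteqP; split=> g.
  case=> dg thg; exists (inner_aut (invmx B) g); last exact: inner_autVK.
  split; first by rewrite /SL2 /= det_inner_aut ?unitmx_inv.
  have: map_mx tau (inner_aut (invmx B) g) = inner_aut (invmx B) g.
    rewrite -[LHS](inner_autK _ Bu) -thetaE inner_autVK //.
    by rewrite [inner_aut A _]thg.
  by move=> /matrixP E i j; rewrite /= -[RHS]E [RHS]mxE.
case=> h [dh hfix] <-; split; first by rewrite /SL2 /= det_inner_aut.
rewrite /= thetaE; congr inner_aut; apply/matrixP => i j; rewrite mxE; exact: hfix.
Qed.
End TwistedFixedPoints.

Section TwistedConjugation.
Variables (K : fieldType) (tau : {rmorphism K -> K}).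
Implicit Types z y c lam al : K.

(** The columns are the averages [v + lam A tau(v)] of the vectors [(1, 0)] and
    [(al, 0)], where [A] is the matrix in [twisted_basisE]. *)
Definition twisted_basis z lam al : 'M[K]_2 :=
  mx2 (1 + lam * z) (al - lam * z * al) lam (- (lam * al)).

(** Since [A tau(A)] is the scalar [z * tau z + y], the map [B |-> lam A tau(B)]
    is an involution under the hypothesis on [lam], and averages are fixed. *)
Lemma twisted_basisE z y lam al :
  tau al = - al -> lam * tau lam * (z * tau z + y) = 1 ->
  lam *: (mx2 z y 1 (- tau z) *m map_mx tau (twisted_basis z lam al)) =
  twisted_basis z lam al.
Proof.
move=> tal lamN; rewrite /twisted_basis map_mx2 mulmx2 scale_mx2.
rewrite !rmorphD !rmorphN !rmorphM rmorph1 tal.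
congr mx2.
- transitivity (lam * tau lam * (z * tau z + y) + lam * z); [ring | by rewrite lamN].
- transitivity (lam * tau lam * (z * tau z + y) * al - lam * z * al); first by ring.
  by rewrite lamN mul1r.
- ring.
- ring.
Qed.

Lemma twisted_basis_unit z lam al :
  2%:R * (lam * al) != 0 -> twisted_basis z lam al \in unitmx.
Proof.
move=> h; rewrite unitmxE unitfE det_mx2.
rewrite (_ : _ - _ = - (2%:R * (lam * al))) ?oppr_eq0 //; ring.
Qed.

(** The conjugate, by a unipotent matrix with corner entry [z], of the element
    with rows [(a, c * tau e)] and [(e, tau a)] of the cyclic algebra attached
    to [c]. *)
Definition twisted_mx z c a e : 'M[K]_2 :=
  mx2 (a + z * e) (c * tau e + z * tau a - z * a - z ^+ 2 * e) e (tau a - z * e).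

Lemma det_twisted_mx z c a e : \det (twisted_mx z c a e) = a * tau a - c * (e * tau e).
Proof. by rewrite det_mx2; ring. Qed.

(** The first column of [A tau(g) = g A] expresses the second column of [g]
    by its first column. *)
Lemma twisted_fixed_pointsE z y : involutive tau -> tau y = y ->
  mx2 z y 1 (- tau z) \in unitmx ->
  let c := z * tau z + y in
  fixed_points (SL2 K) (inner_aut (mx2 z y 1 (- tau z)) \o map_mx tau) =
  [set twisted_mx z c ae.1 ae.2 | ae in
    [set ae : K * K | ae.1 * tau ae.1 - c * (ae.2 * tau ae.2) = 1]].
Proof.
move=> tauK ty Au c; apply/seteqP; split=> g.
  case=> dg /inner_aut_eq-/(_ Au); move: dg; rewrite (mx2_eta g).
  move: (g 0 0) (g 0 1) (g 1 0) (g 1 1) => g0 g1 g2 g3 dg.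
  rewrite map_mx2 !mulmx2 => /mx2_inj[E0 _ E2 _].
  have gE : mx2 g0 g1 g2 g3 = twisted_mx z c (g0 - z * g2) g2.
    rewrite /twisted_mx rmorphB rmorphM; congr mx2; first by ring.
      transitivity (g0 * z + g1 * 1 - g0 * z); first by ring.
      by rewrite -E0 /c; ring.
    transitivity (g2 * z + g3 * 1 - g2 * z); first by ring.
    by rewrite -E2; ring.
  exists (g0 - z * g2, g2) => //=.
  by rewrite -(det_twisted_mx z) -gE.
case=> -[a e] /= ae1 <-; split; first by rewrite /SL2 /= det_twisted_mx.
apply/inner_aut_eq => //; rewrite map_mx2 !mulmx2.
rewrite !(rmorphD, rmorphN, rmorphM, rmorphXn) !tauK ty /=.
congr mx2; rewrite /c; ring.
Qed.
End TwistedConjugation.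

(** Adjoining a square root of [c + d v^2] makes [c] a norm. Only squares and
    [d] times squares have to be avoided, the former being excluded by the
    hypothesis on [c]. If [v = 0] fails then [c = d w^2], and [v = w t] replaces
    the radicand by [d w^2 (1 + t^2)], where [1 + t^2] is not a square for a
    suitable [t]. *)
Lemma splitting_radicand (F : fieldType) (c d : F) :
  (exists (n : nat) (t : F), t ^+ 2 = n%:R /\ forall s : F, s ^+ 2 <> n.+1%:R) ->
  (forall u v, u ^+ 2 - d * v ^+ 2 <> c) ->
  exists v, (forall r, r ^+ 2 <> c + d * v ^+ 2) /\
            (forall r, d * r ^+ 2 <> c + d * v ^+ 2).
Proof.
move=> [n [t [tn nN]]] cN.
have sqN v r : r ^+ 2 <> c + d * v ^+ 2.
  by move=> E; apply: (cN r v); rewrite E addrK.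
have [[w wE]|nw] := pselect (exists w, d * w ^+ 2 = c); last first.
  exists 0; split=> // r; rewrite expr0n mulr0 addr0 => E; apply: nw.
  by exists r.
exists (w * t); split=> // r E.
have dw0 : d * w ^+ 2 != 0.
  by apply/eqP; rewrite wE => c0; apply: (cN 0 0); rewrite c0; ring.
move: dw0; rewrite mulf_eq0 sqrf_eq0 negb_or => /andP[d0 w0].
apply: (nN (r / w)); apply: (mulfI d0).
rewrite expr_div_n mulrA E -wE exprMn tn -(natr1 n); field.
by rewrite w0.
Qed.

(** The form is the reduced norm of a quaternion algebra. A nontrivial zero
    would write [c] as a quotient of two norms from the extension by a square
    root of [d], which is again a norm. *)
Lemma norm_form_anisotropic (F : fieldType) (c d : F) :
  (forall r, r ^+ 2 <> d) -> (forall u v, u ^+ 2 - d * v ^+ 2 <> c) ->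
  forall u v u' v' : F,
    (u ^+ 2 - d * v ^+ 2) - c * (u' ^+ 2 - d * v' ^+ 2) = 0 ->
    [/\ u = 0, v = 0, u' = 0 & v' = 0].
Proof.
move=> dN cN.
have N0 u v : u ^+ 2 - d * v ^+ 2 = 0 -> u = 0 /\ v = 0.
  have [-> |v0 /eqP] := eqVneq v 0.
    by rewrite expr0n mulr0 subr0 => /eqP; rewrite sqrf_eq0 => /eqP.
  rewrite subr_eq0 => /eqP E; case: (dN (u / v)); rewrite expr_div_n E.
  by rewrite mulfK // sqrf_eq0.
move=> u v u' v' E.
have [Ne|Ne] := eqVneq (u' ^+ 2 - d * v' ^+ 2) 0.
  by move: E; rewrite Ne mulr0 subr0 => /N0[-> ->]; have [-> ->] := N0 _ _ Ne.
case: (cN ((u * u' - d * v * v') / (u' ^+ 2 - d * v' ^+ 2))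
          ((v * u' - u * v') / (u' ^+ 2 - d * v' ^+ 2))).
move/eqP: E; rewrite subr_eq0 => /eqP E.
apply: (mulIf Ne); rewrite -E; field; exact: Ne.
Qed.

(** * Fixed point groups *)

Lemma antidiagonal_fixed_points (F : fieldType) (a : F) : a != 0 ->
  fixed_points (SL2 F) (inner_aut (mx2 0 1 a 0)) =
  [set g | SL2 F g /\
     exists x y : F, g = mx2 x y (a * y) x /\ x ^+ 2 - a * y ^+ 2 = 1].
Proof.
move=> a0; have Au : mx2 0 1 a 0 \in unitmx.
  by rewrite unitmxE unitfE det_mx2 mul0r mul1r sub0r oppr_eq0.
apply/seteqP; split=> g [dg].
  move/(inner_aut_eq _ _ Au); move: dg; rewrite /SL2 /= (mx2_eta g).
  move: (g 0 0) (g 0 1) (g 1 0) (g 1 1) => g0 g1 g2 g3 dg.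
  rewrite !mulmx2 => /mx2_inj[].
  rewrite !(mul0r, mulr0, mul1r, mulr1, add0r, addr0) => e2 e3 _ _.
  split=> //; exists g0, g1; rewrite e2 e3 [g1 * a]mulrC; split=> //.
  by rewrite -dg det_mx2 e2 e3; ring.
case=> x [y [-> xy]]; split; first by rewrite /SL2 /= det_mx2 -xy; ring.
by apply/(inner_aut_eq _ _ Au); rewrite !mulmx2; congr mx2; ring.
Qed.

Section QuadraticInvolution.
Variables (F : fieldType) (E : fieldExtType F) (alpha : E) (d : F).
Variable sigma : {rmorphism E -> E}.
Hypotheses (dimE : \dim {:E} = 2%N) (alphaN1 : alpha \notin 1%VS).
Hypothesis alpha2 : alpha ^+ 2 = d%:A.
Hypothesis sigmaE :
  forall u v : F, sigma (u%:A + alpha * v%:A) = u%:A - alpha * v%:A.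

Let algM (L : fieldExtType F) (u v : F) : (u * v)%:A = u%:A * v%:A :> L.
Proof. exact: (rmorphM (in_alg L)). Qed.

Lemma conj_alg (u : F) : sigma u%:A = u%:A.
Proof. by have := sigmaE u 0; rewrite scale0r mulr0 subr0 addr0. Qed.

Lemma conj_alpha : sigma alpha = - alpha.
Proof. by have := sigmaE 0 1; rewrite scale0r scale1r mulr1 add0r sub0r. Qed.

Lemma conj_involutive : involutive sigma.
Proof.
move=> x; have [u [v ->]] := quadratic_span dimE alphaN1 x.
by rewrite sigmaE rmorphB rmorphM !conj_alg conj_alpha mulNr opprK.
Qed.

Lemma conj_normE (u v : F) :
  (u%:A + alpha * v%:A) * sigma (u%:A + alpha * v%:A) = (u ^+ 2 - d * v ^+ 2)%:A.
Proof.
rewrite sigmaE; transitivity (u%:A ^+ 2 - alpha ^+ 2 * v%:A ^+ 2); first by ring.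
by rewrite alpha2 scalerBl !expr2 !algM.
Qed.

Lemma alpha_neq0 : alpha != 0.
Proof. by apply: contraNneq alphaN1 => ->; rewrite mem0v. Qed.

(** A fixed point of determinant one is given by two elements of [E], hence by
    four coordinates over [F], on which the determinant is the reduced norm. *)
Lemma twisted_fixed_points_image (z : E) (c y : F) :
  mx2 z y%:A 1 (- sigma z) \in unitmx -> z * sigma z + y%:A = c%:A ->
  (forall u v, u ^+ 2 - d * v ^+ 2 <> c) ->
  exists (coef : 'I_4 -> F) (P : 'I_4 -> 'M[E]_2),
    (forall x : 'I_4 -> F, \sum_i coef i * x i ^+ 2 = 0 -> forall i, x i = 0) /\
    fixed_points (SL2 E) (inner_aut (mx2 z y%:A 1 (- sigma z)) \o map_mx sigma) =
    [set \sum_i (x i)%:A *: P i | x in [set x : 'I_4 -> F | \sum_i coef i * x i ^+ 2 = 1]].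
Proof.
move=> Au cE cN.
have spanE := quadratic_span dimE alphaN1.
have dN r : r ^+ 2 <> d.
  move=> rd; have /eqP : alpha ^+ 2 = r%:A ^+ 2.
    by rewrite alpha2 -rd !expr2 algM.
  rewrite eqf_sqr => /orP[] /eqP aE; move/vlineP: alphaN1; apply.
    by exists r.
  exists (- r) => //.
  by rewrite scaleNr.
pose coef (i : 'I_4) := nth 0 [:: 1; - d; - c; c * d] i.
pose P (i : 'I_4) : 'M[E]_2 := nth 0
  [:: twisted_mx sigma z c%:A 1 0; twisted_mx sigma z c%:A alpha 0;
      twisted_mx sigma z c%:A 0 1; twisted_mx sigma z c%:A 0 alpha] i.
exists coef, P; rewrite (twisted_fixed_pointsE conj_involutive (conj_alg y) Au) cE.
pose i1 : 'I_4 := lift ord0 ord0.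
pose i2 : 'I_4 := lift ord0 (lift ord0 ord0).
pose i3 : 'I_4 := lift ord0 (lift ord0 (lift ord0 ord0)).
have sumE (x : 'I_4 -> F) : \sum_i coef i * x i ^+ 2 =
  (x ord0 ^+ 2 - d * x i1 ^+ 2) - c * (x i2 ^+ 2 - d * x i3 ^+ 2).
  by rewrite !big_ord_recl big_ord0 /coef /=; ring.
have PE (x : 'I_4 -> F) : \sum_i (x i)%:A *: P i =
  twisted_mx sigma z c%:A ((x ord0)%:A + alpha * (x i1)%:A)
     ((x i2)%:A + alpha * (x i3)%:A).
  rewrite !big_ord_recl big_ord0 /P /= addr0 /twisted_mx !scale_mx2 !add_mx2 !sigmaE.
  rewrite rmorph0 rmorph1 conj_alpha -/i1 -/i2 -/i3; congr mx2; ring.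
have levelE (x : 'I_4 -> F) : \sum_i coef i * x i ^+ 2 = 1 <->
  let a := (x ord0)%:A + alpha * (x i1)%:A in
  let e := (x i2)%:A + alpha * (x i3)%:A in a * sigma a - c%:A * (e * sigma e) = 1.
  rewrite /= !conj_normE sumE -algM -scalerBl.
  split=> [->|E1]; first by rewrite scale1r.
  by apply: (fmorph_inj (in_alg E)); rewrite /= E1 scale1r.
split.
  move=> x; rewrite sumE => /(norm_form_anisotropic dN cN)[x0 x1 x2 x3].
  case=> [[|[|[|[|i]]]] Hi] //; [move: x0 | move: x1 | move: x2 | move: x3];
    by move=> xi; rewrite -[RHS]xi; congr x; apply: val_inj.
apply/seteqP; split=> g.
  case=> -[a e] /=; have [u [v ->]] := spanE a; have [u' [v' ->]] := spanE e.
  move=> ae <-; exists (fun i => nth 0 [:: u; v; u'; v'] i); last by rewrite PE.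
  exact/levelE.
case=> x /levelE xl <-; rewrite PE.
by eexists (_, _); first exact: xl.
Qed.

Hypothesis two_neq0 : 2%:R != 0 :> F.

Lemma two_neq0_ext : 2%:R != 0 :> E.
Proof. by rewrite -(rmorph_nat (in_alg E)) fmorph_eq0. Qed.

Lemma conj_fixed : [set x : E | sigma x = x] = range (in_alg E).
Proof.
apply/seteqP; split=> [x /= |_ [u _ <-] /=]; last exact: conj_alg.
have [u [v ->]] := quadratic_span dimE alphaN1 x; rewrite sigmaE => /eqP.
rewrite -subr_eq0 (_ : _ - _ = - (2%:R * (alpha * v%:A))); last by ring.
rewrite oppr_eq0 !mulf_eq0 (negPf two_neq0_ext) (negPf alpha_neq0) /= => /eqP ->.
by rewrite mulr0 addr0; exists u.
Qed.

(** Here [mu] is a multiplicative Hilbert 90 witness for [x]: the average [1 + x],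
    or [alpha] in the exceptional case [x = - 1]. *)
Lemma diagonal_descent (x : E) : x * sigma x = 1 ->
  exists2 B : 'M[E]_2, B \in unitmx &
    fixed_points (SL2 E) (inner_aut (mx2 x 0 0 1) \o map_mx sigma) =
    [set inner_aut B g | g in SL2_in (range (in_alg E))].
Proof.
move=> x1; have x0 : x != 0.
  by apply/eqP => x0; move/eqP: x1; rewrite x0 mul0r eq_sym oner_eq0.
have [mu mu0 muE] : exists2 mu, mu != 0 & x * sigma mu = mu.
  have [xN1|xN1] := eqVneq (1 + x) 0.
    exists alpha; first exact: alpha_neq0.
    have -> : x = - 1 by apply/eqP; rewrite -subr_eq0 opprK addrC xN1.
    by rewrite conj_alpha mulrNN mul1r.
  by exists (1 + x) => //; rewrite rmorphD rmorph1 mulrDr mulr1 x1 addrC.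
have Bu : mx2 mu 0 0 1 \in unitmx.
  by rewrite unitmxE unitfE det_mx2 mulr1 mulr0 subr0.
exists (mx2 mu 0 0 1) => //; rewrite -conj_fixed.
apply: (fixed_points_descent (lam := 1)) => //.
  by rewrite unitmxE unitfE det_mx2 mulr1 mulr0 subr0.
rewrite map_mx2 mulmx2 scale_mx2 rmorph0 rmorph1 muE.
by congr mx2; ring.
Qed.

Lemma norm_descent (z w : E) (y : F) :
  mx2 z y%:A 1 (- sigma z) \in unitmx ->
  w != 0 -> w * sigma w = z * sigma z + y%:A ->
  exists2 B : 'M[E]_2, B \in unitmx &
    fixed_points (SL2 E) (inner_aut (mx2 z y%:A 1 (- sigma z)) \o map_mx sigma) =
    [set inner_aut B g | g in SL2_in (range (in_alg E))].
Proof.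
move=> Au w0 wE; exists (twisted_basis z w^-1 alpha).
  by apply: twisted_basis_unit; rewrite !mulf_neq0 ?two_neq0_ext ?invr_eq0 ?alpha_neq0.
have Bu : twisted_basis z w^-1 alpha \in unitmx.
  by apply: twisted_basis_unit; rewrite !mulf_neq0 ?two_neq0_ext ?invr_eq0 ?alpha_neq0.
rewrite -conj_fixed; apply: (fixed_points_descent (lam := w^-1)) => //.
apply: twisted_basisE; first exact: conj_alpha.
by rewrite -wE fmorphV -invfM mulVf // mulf_neq0 // fmorph_eq0.
Qed.

(** With [K = E(b)] and [b ^ 2 = c + d v ^ 2], the conjugation extended so as to
    fix [b] has fixed field [F(b)], and [c] is the norm of [b + alpha v]. *)
Lemma splitting_descent (z : E) (c y v : F) :
  mx2 z y%:A 1 (- sigma z) \in unitmx -> z * sigma z + y%:A = c%:A -> c != 0 ->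
  (forall r, r ^+ 2 <> c + d * v ^+ 2) -> (forall r, d * r ^+ 2 <> c + d * v ^+ 2) ->
  let H := fixed_points (SL2 E) (inner_aut (mx2 z y%:A 1 (- sigma z)) \o map_mx sigma) in
  exists (K : fieldExtType E) (tau : {rmorphism K -> K}),
    [/\ 1%VS <> {:K}%VS,
        forall x : E, tau x%:A = (sigma x)%:A,
        involutive tau &
        let Ktau := [set x : K | tau x = x] in
        (forall u : K, exists! x : K * K,
           [/\ Ktau x.1, Ktau x.2 & u = x.1 + alpha%:A * x.2]) /\
        exists2 B : 'M[K]_2, B \in unitmx &
          [set map_mx (in_alg K) g | g in H] =
          [set inner_aut B g | g in SL2_in Ktau] `&`
          [set map_mx (in_alg K) g | g in SL2 E]].
Proof.
move=> Au cE c0; set m := c + d * v ^+ 2 => mN1 mN2 H.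
(* Squaring [a + alpha b] gives an element of [F] only if [a = 0] or [b = 0]. *)
have mN (r : E) : r ^+ 2 <> m%:A.
  have [a [b ->]] := quadratic_span dimE alphaN1 r => abm.
  have : (a ^+ 2 + d * b ^+ 2)%:A + alpha * (a * b + a * b)%:A = m%:A + alpha * 0%:A.
    by rewrite scale0r mulr0 addr0 -abm !scalerDl !expr2 !algM -alpha2; ring.
  case/(quadratic_coord_uniq alphaN1) => abE /eqP.
  rewrite -mulr2n -mulr_natl !mulf_eq0 (negPf two_neq0) /=.
  case/orP=> /eqP ab0; rewrite ab0 expr0n /= in abE.
    by apply: (mN2 b); rewrite -abE add0r.
  by apply: (mN1 a); rewrite -abE mulr0 addr0.
have [K [b [dimK bN1 b2]]] := quadratic_extension mN.
have b2' : b ^+ 2 = (sigma m%:A)%:A by rewrite conj_alg.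
have algMK (u u' : E) : (u * u')%:A = u%:A * u'%:A :> K := rmorphM (in_alg K) u u'.
have [tau tauE] := quadratic_morphism dimK bN1 b2 b2'.
have tau_alg (x : E) : tau x%:A = (sigma x)%:A.
  by have := tauE x 0; rewrite rmorph0 scale0r !mulr0 !addr0.
have tau_b : tau b = b.
  by have := tauE 0 1; rewrite rmorph0 rmorph1 scale0r scale1r !mulr1 !add0r.
have tauK : involutive tau.
  move=> x; have [u [u' ->]] := quadratic_span dimK bN1 x.
  by rewrite !(rmorphD, rmorphM, tau_alg, tau_b) !conj_involutive.
have tau_alpha : tau alpha%:A = - alpha%:A by rewrite tau_alg conj_alpha scaleNr.
have alphaK0 : alpha%:A != 0 :> K by rewrite scaler_eq0 oner_eq0 orbF alpha_neq0.
have twoK : 2%:R != 0 :> K by rewrite -(rmorph_nat (in_alg K)) fmorph_eq0 two_neq0_ext.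
exists K, tau; split=> //.
  by move/(congr1 (fun V : {vspace K} => \dim V)); rewrite dimv1 dimK.
move=> Ktau; split.
  move=> u; exists ((u + tau u) / 2%:R, (u - tau u) / (2%:R * alpha%:A)); split.
    split=> /=.
    - by rewrite /Ktau /= fmorph_div rmorphD rmorph_nat tauK addrC.
    - rewrite /Ktau /= fmorph_div rmorphB rmorphM rmorph_nat tauK tau_alpha.
      by rewrite mulrN invrN mulrN -mulNr opprB.
    - by field; rewrite ?twoK ?alphaK0.
  case=> x1 x2 [/= f1 f2 ->].
  rewrite rmorphD rmorphM tau_alpha f1 f2; congr (_, _); field; rewrite ?twoK ?alphaK0 //.
pose w := b + (alpha * v%:A)%:A.
have wE : w * tau w = (z%:A * tau z%:A + y%:A%:A).
  have -> : z%:A * tau z%:A + y%:A%:A = c%:A%:A :> K.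
    by rewrite tau_alg -algMK -scalerDl cE.
  rewrite /w rmorphD tau_b tau_alg rmorphM conj_alg conj_alpha.
  transitivity ((m%:A - alpha ^+ 2 * v%:A ^+ 2)%:A : K).
    by rewrite scalerBl -b2 !expr2 !algMK scaleNr; ring.
  rewrite (_ : m%:A - _ = c%:A) //.
  by rewrite alpha2 /m scalerDl !expr2 !algM addrK.
have w0 : w != 0.
  apply: contraNneq c0 => w0; rewrite -(fmorph_eq0 (in_alg E)) -(fmorph_eq0 (in_alg K)) /=.
  by move: wE; rewrite w0 mul0r tau_alg -algMK -scalerDl cE => <-.
pose zK : K := z%:A; pose yK : K := y%:A%:A.
have AE : map_mx (in_alg K) (mx2 z y%:A 1 (- sigma z)) = mx2 zK yK 1 (- tau zK).
  by rewrite map_mx2 /= scale1r scaleNr tau_alg.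
have Bu : twisted_basis zK w^-1 alpha%:A \in unitmx.
  by apply: twisted_basis_unit; rewrite !mulf_neq0 ?invr_eq0.
exists (twisted_basis zK w^-1 alpha%:A) => //.
rewrite -(fixed_points_descent (tau := tau) (A := mx2 zK yK 1 (- tau zK))
  (lam := w^-1)) //; last first.
- apply: twisted_basisE => //.
  by rewrite -wE fmorphV -invfM mulVf // mulf_neq0 // fmorph_eq0.
- by rewrite -AE map_unitmx.
have thetaE g : inner_aut (mx2 zK yK 1 (- tau zK)) (map_mx tau (map_mx (in_alg K) g)) =
    map_mx (in_alg K) (inner_aut (mx2 z y%:A 1 (- sigma z)) (map_mx sigma g)).
  rewrite inner_aut_map AE -!map_mx_comp; congr inner_aut.
  by apply: eq_map_mx => x /=; rewrite tau_alg.
apply/seteqP; split=> [h [g [dg fg] <-]|h [fg [g dg gE]]].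
  split; last by exists g.
  by split; [rewrite /SL2 /= det_map_mx dg rmorph1 | rewrite /= thetaE [inner_aut _ _]fg].
move: fg; rewrite -gE => -[_ fg]; exists g => //; split=> //.
by apply: (map_mx_inj (f := in_alg K)); rewrite /= -thetaE.
Qed.
End QuadraticInvolution.

Theorem theorem1p2 (p : nat) (p_pr : prime p) (p_neq2 : p <> 2%N) :
  (forall (F : fieldExtType (padic p_pr)) (a : F), a != 0 ->
     let theta_a := inner_aut (mx2 0 1 a 0) in
     fixed_points (SL2 F) theta_a =
     [set g | SL2 F g /\
        exists x y : F, g = mx2 x y (a * y) x /\ x ^+ 2 - a * y ^+ 2 = 1])
  /\
  (forall (E : fieldExtType (padic p_pr)) (alpha : E) (sigma : E -> E)
          (A : 'M[E]_2),
     \dim {:E} = 2%N ->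
     <<1; alpha>>%VS = {:E}%VS ->
     alpha \notin 1%VS ->
     alpha ^+ 2 \in 1%VS ->
     (forall a b : padic p_pr,
        sigma (a%:A + alpha * b%:A) = a%:A - alpha * b%:A) ->
     A \in unitmx ->
     (exists (z : E) (y : padic p_pr),
        A = mx2 z y%:A 1 (- sigma z) /\ z * sigma z + y%:A != 0) \/
     (exists x : E, A = mx2 x 0 0 1 /\ x * sigma x = 1) ->
     let theta := inner_aut A \o map_mx sigma in
     abstract_involution theta ->
     let H := fixed_points (SL2 E) theta in
     (exists2 B : 'M[E]_2, B \in unitmx &
        H = [set inner_aut B g | g in SL2_in (range (in_alg E))]) \/
     ((exists (K : fieldExtType E) (tau : {rmorphism K -> K}),
         [/\ 1%VS <> {:K}%VS,
             forall x : E, tau x%:A = (sigma x)%:A,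
             involutive tau &
             let Ktau := [set x : K | tau x = x] in
             (forall u : K, exists! x : K * K,
                [/\ Ktau x.1, Ktau x.2 & u = x.1 + alpha%:A * x.2]) /\
             exists2 B : 'M[K]_2, B \in unitmx &
               [set map_mx (in_alg K) g | g in H] =
               [set inner_aut B g | g in SL2_in Ktau] `&`
               [set map_mx (in_alg K) g | g in SL2 E]])
      /\ (compact (H : set (mx_top E)) \/ H = [set 1%:M]))).
Proof.
split=> [F a a0|]; first exact: antidiagonal_fixed_points.
move=> E alpha sigma0 A dimE _ alphaN1 /vlineP[d alpha2] sigma0E Au Acase theta _ H.
have nalpha2 : (- alpha) ^+ 2 = (idfun d)%:A by rewrite sqrrN.
(* The conjugation is given as a mere function; this is its ring structure. *)
have [sigma sigmaE0] := quadratic_morphism dimE alphaN1 (s := idfun) alpha2 nalpha2.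
have {}sigmaE0 (u v : padic p_pr) : sigma (u%:A + alpha * v%:A) = u%:A - alpha * v%:A.
  by rewrite sigmaE0 mulNr.
have sigma0_eq : sigma0 = sigma :> (E -> E).
  apply: functional_extensionality_dep => x.
  by have [u [v ->]] := quadratic_span dimE alphaN1 x; rewrite sigma0E sigmaE0.
have two_neq0 : 2%:R != 0 :> padic p_pr by exact: padic_natr_neq0.
rewrite {}/H {}/theta; subst sigma0.
case: Acase => [[z [y [AE cN0]]]|[x [-> x1]]]; last first.
  by left; apply: (diagonal_descent dimE alphaN1 sigmaE0).
rewrite {}AE in Au *.
have [zu [zv zE]] := quadratic_span dimE alphaN1 z.
pose c := zu ^+ 2 - d * zv ^+ 2 + y.
have cE : z * sigma z + y%:A = c%:A.
  by rewrite zE (conj_normE alpha2 sigmaE0) -scalerDl.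
have c0 : c != 0.
  by apply: contraNneq cN0 => c0; rewrite cE c0 scale0r.
have [[u [v uvE]]|cN] := pselect (exists u v, u ^+ 2 - d * v ^+ 2 = c).
  left; pose w := u%:A + alpha * v%:A.
  have wE : w * sigma w = c%:A by rewrite (conj_normE alpha2 sigmaE0) uvE.
  apply: (norm_descent dimE alphaN1 sigmaE0 two_neq0 Au (w := w)); last by rewrite cE.
  by apply: contraNneq cN0 => w0; rewrite cE -wE w0 mul0r.
have {}cN u v : u ^+ 2 - d * v ^+ 2 <> c by move=> uv; apply: cN; exists u, v.
right; split.
  have [v [vN1 vN2]] := splitting_radicand (padic_sqr_succ_not_sqr p_pr) cN.
  exact: (splitting_descent dimE alphaN1 alpha2 sigmaE0 two_neq0 Au cE c0 vN1 vN2).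
left; have [coef [P [aniso ->]]] :=
  twisted_fixed_points_image dimE alphaN1 alpha2 sigmaE0 Au cE cN.
exact: compact_anisotropic_level.
Qed.
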